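(* Let $\mathsf h$ and $\mathsf H$ be Hilbert spaces. The composition $(\Gamma_1,\Gamma_2)\mapsto\Gamma_1\lhd\Gamma_2$ endows $\mathcal Q(\mathsf h\oplus\mathsf H)$ with the structure of a $*$-monoid (involutive semigroup with identity; the involution being the adjoint operation $\Gamma\mapsto\Gamma^*$) whose identity element is $\Gamma_0\sim(0,0,0,I)$. In particular, $$(\Gamma_1\lhd\Gamma_2)^*=\Gamma_2^*\lhd\Gamma_1^*\qquad(\Gamma_1,\Gamma_2\in\mathcal Q(\mathsf h\oplus\mathsf H)).$$
   Context: Hilbert spaces are complex, with inner products linear in the second argument. $\mathcal Q(\mathsf h\oplus\mathsf H)$ is the class of quadratic forms $\Gamma$ on $\mathsf h\oplus\mathsf H$ with $\mathrm{Dom}\,\Gamma=\mathcal D\oplus\mathsf H$ for some (not necessarily dense) subspace $\mathcal D$ of $\mathsf h$ and $$\Gamma[\xi]=\gamma[u]-\big[\langle\zeta,Lu\rangle+\langle\widetilde Lu,\zeta\rangle+\langle\zeta,(C-I)\zeta\rangle\big],\qquad\xi=\tbinom u\zeta\in\mathrm{Dom}\,\Gamma,$$ where $C\in B(\mathsf H)$, $\gamma$ is a quadratic form on $\mathsf h$, $L,\widetilde L$ are (linear) operators from $\mathsf h$ to $\mathsf H$, and $\mathrm{Dom}\,\gamma=\mathrm{Dom}\,L=\mathrm{Dom}\,\widetilde L=\mathcal D$ (a quadratic form is the diagonal of a sesquilinear form on its domain). One writes $\Gamma\sim(\gamma,L,\widetilde L,C)$. The adjoint form is $\Gamma^*[\xi]=\overline{\Gamma[\xi]}$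 on $\mathrm{Dom}\,\Gamma$, so $\Gamma^*\sim(\gamma^*,\widetilde L,L,C^* )$ with $\gamma^*[u]=\overline{\gamma[u]}$. The form $\Gamma_0\sim(0,0,0,I)$ has domain $\mathsf h\oplus\mathsf H$, i.e. it is the zero form. For $\Gamma_i\sim(\gamma_i,L_i,\widetilde L_i,C_i)$ with domain $\mathcal D_i\oplus\mathsf H$ ($i=1,2$), $\Gamma_1\lhd\Gamma_2$ is the form with domain $(\mathcal D_1\cap\mathcal D_2)\oplus\mathsf H$ and components $(\gamma,L,\widetilde L,C)$ where $$\gamma[u]=\gamma_1[u]+\gamma_2[u]-\langle\widetilde L_1u,L_2u\rangle,\quad L=L_1+C_1L_2,\quad\widetilde L=C_2^*\widetilde L_1+\widetilde L_2,\quad C=C_1C_2 .$$ *)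

(* Defs.v *)
From HB Require Import structures.
From mathcomp Require Import all_boot all_order all_algebra.
From mathcomp Require Import boolp classical_sets reals topology normedtype.
From mathcomp Require Import complex ring.

Set Implicit Arguments.
Unset Strict Implicit.
Unset Printing Implicit Defensive.

Import Order.TTheory GRing.Theory Num.Theory.
Import numFieldNormedType.Exports.

Local Open Scope classical_set_scope.
Local Open Scope ring_scope.

Reserved (* Conjugate-linear in the first argument, linear in the second. *)
Notation "'<| x , y |>" (at level 0, x at level 99, y at level 99,
  format "''<|' x ,  y '|>'").

HB.mixin Record hasInner (R : realType) V & CompleteNormedModule R[i] V := {
  inner : V -> V -> R[i] ;
  inner_linearr : forall (x : V) (a : R[i]) (y z : V),
    inner x (a *: y + z) = a * inner x y + inner x z ;
  inner_conj : forall x y : V, inner y x = (inner x y)^* ;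
  inner_norm : forall x : V, inner x x = `|x| ^+ 2
}.

#[short(type="hilbertType")]
HB.structure Definition Hilbert (R : realType) :=
  {V of CompleteNormedModule R[i] V & hasInner R V}.

(* Conjugate-linear in the first argument, linear in the second. *)
Notation "'<| x , y |>" := (inner x y) : ring_scope.


Section Subspaces.
Context {R : realType} {V : lmodType R[i]}.

Definition subspace (D : set V) : Prop :=
  D 0 /\ forall (a : R[i]) (u v : V), D u -> D v -> D (a *: u + v).

Definition sesquilinear_on (D : set V) (q : V -> V -> R[i]) : Prop :=
  (forall (a : R[i]) (u v w : V), D u -> D v -> D w ->
     q u (a *: v + w) = a * q u v + q u w) /\
  (forall (a : R[i]) (u v w : V), D u -> D v -> D w ->
     q (a *: u + v) w = a^* * q u w + q v w).

Lemma subspaceT : subspace setT.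
Proof. by []. Qed.

Lemma subspaceI (D E : set V) : subspace D -> subspace E -> subspace (D `&` E).
Proof.
move=> [D0 DZ] [E0 EZ]; split=> // a u v [Du Eu] [Dv Ev].
by split; [exact: DZ | exact: EZ].
Qed.

Lemma sesquilinear_onS (D E : set V) (q : V -> V -> R[i]) :
  D `<=` E -> sesquilinear_on E q -> sesquilinear_on D q.
Proof.
move=> DE [qr ql]; split=> a u v w Du Dv Dw.
  by apply: qr; exact: DE.
by apply: ql; exact: DE.
Qed.

End Subspaces.

(* Forms and operators have a domain; they are stored as total functions that
   vanish off the domain, so that equality of records is equality of domains
   together with equality of values on the domain. *)
Definition on {T : Type} {W : nmodType} (D : set T) (f : T -> W) : T -> W :=
  fun u => if pselect (D u) then f u else 0.

Lemma onT {T : Type} {W : nmodType} (D : set T) (f : T -> W) (u : T) :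
  D u -> on D f u = f u.
Proof. by rewrite /on; case: pselect. Qed.

Lemma onN {T : Type} {W : nmodType} (D : set T) (f : T -> W) (u : T) :
  ~ D u -> on D f u = 0.
Proof. by rewrite /on; case: pselect. Qed.

Record qform (R : realType) (V : lmodType R[i]) := QForm {
  qdom : set V ;
  qval :> V -> R[i] ;
  qdom_subspace : subspace qdom ;
  qval_diag : exists2 q, sesquilinear_on qdom q &
                forall u, qdom u -> qval u = q u u ;
  qval_off : forall u, ~ qdom u -> qval u = 0
}.

Record linop (R : realType) (V W : lmodType R[i]) := LinOp {
  ldom : set V ;
  lval :> V -> W ;
  ldom_subspace : subspace ldom ;
  lval_linear : forall (a : R[i]) (u v : V), ldom u -> ldom v ->
    lval (a *: u + v) = a *: lval u + lval v ;
  lval_off : forall u, ~ ldom u -> lval u = 0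
}.

Record bop (R : realType) (H : normedModType R[i]) := BOp {
  bfun :> {linear H -> H} ;
  bfun_bounded : exists M : R[i], forall x, `|bfun x| <= M * `|x|
}.

Section Forms.
Context {R : realType} {V : lmodType R[i]}.

Lemma qform_on_diag (D : set V) (q : V -> V -> R[i]) :
  sesquilinear_on D q ->
  exists2 q', sesquilinear_on D q' &
    forall u, D u -> on D (fun v => q v v) u = q' u u.
Proof. by move=> qD; exists q => // u Du; rewrite onT. Qed.

Lemma zero_form_diag : exists2 q : V -> V -> R[i], sesquilinear_on setT q &
  forall u, setT u -> 0 = q u u.
Proof.
by exists (fun _ _ => 0) => //; split=> a u v w _ _ _; rewrite mulr0 addr0.
Qed.

Definition zero_form : qform V :=
  @QForm R V setT (fun=> 0) subspaceT zero_form_diag (fun _ _ => erefl).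

Lemma add_form_diag (g1 g2 : qform V) :
  exists2 q, sesquilinear_on (qdom g1 `&` qdom g2) q &
    forall u, (qdom g1 `&` qdom g2) u ->
      on (qdom g1 `&` qdom g2) (fun u => g1 u + g2 u) u = q u u.
Proof.
have [q1 [q1r q1l] g1E] := qval_diag g1.
have [q2 [q2r q2l] g2E] := qval_diag g2.
exists (fun u v => q1 u v + q2 u v); last first.
  by move=> u [D1 D2]; rewrite onT// g1E// g2E.
split=> a u v w [u1 u2] [v1 v2] [w1 w2].
  by rewrite q1r// q2r// mulrDr addrACA.
by rewrite q1l// q2l// mulrDr addrACA.
Qed.

Definition add_form (g1 g2 : qform V) : qform V :=
  QForm (subspaceI (qdom_subspace g1) (qdom_subspace g2))
    (add_form_diag g1 g2) (@onN _ _ _ _).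

Lemma opp_form_diag (g : qform V) :
  exists2 q, sesquilinear_on (qdom g) q &
    forall u, qdom g u -> on (qdom g) (fun u => - g u) u = q u u.
Proof.
have [q [qr ql] gE] := qval_diag g.
exists (fun u v => - q u v); last by move=> u Du; rewrite onT// gE.
by split=> a u v w Du Dv Dw; rewrite (qr, ql)// opprD mulrN.
Qed.

Definition opp_form (g : qform V) : qform V :=
  QForm (qdom_subspace g) (opp_form_diag g) (@onN _ _ _ _).

Lemma adj_form_diag (g : qform V) :
  exists2 q, sesquilinear_on (qdom g) q &
    forall u, qdom g u -> on (qdom g) (fun u => (g u)^*) u = q u u.
Proof.
have [q [qr ql] gE] := qval_diag g.
exists (fun u v => (q v u)^*); last by move=> u Du; rewrite onT// gE.
by split=> a u v w Du Dv Dw; rewrite (qr, ql)// rmorphD rmorphM/= ?conjCK.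
Qed.

Definition adj_form (g : qform V) : qform V :=
  QForm (qdom_subspace g) (adj_form_diag g) (@onN _ _ _ _).

End Forms.

Section Operators.
Context {R : realType} {V : lmodType R[i]} {H : hilbertType R}.

Lemma zero_op_linear (a : R[i]) (u v : V) :
  setT u -> setT v -> (0 : H) = a *: 0 + 0.
Proof. by rewrite scaler0 addr0. Qed.

Definition zero_op : linop V H :=
  @LinOp R V H setT (fun=> 0) subspaceT zero_op_linear (fun _ _ => erefl).

Lemma add_op_linear (L1 L2 : linop V H) (a : R[i]) (u v : V) :
  let D := ldom L1 `&` ldom L2 in
  let f := on D (fun u => L1 u + L2 u) in
  D u -> D v -> f (a *: u + v) = a *: f u + f v.
Proof.
move=> D f Du Dv; have [_ DZ] : subspace D.
  by apply: subspaceI; exact: ldom_subspace.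
rewrite /f !onT//; last exact: DZ.
case: Du Dv => [u1 u2] [v1 v2].
by rewrite !lval_linear// scalerDr addrACA.
Qed.

Definition add_op (L1 L2 : linop V H) : linop V H :=
  LinOp (subspaceI (ldom_subspace L1) (ldom_subspace L2))
    (@add_op_linear L1 L2) (@onN _ _ _ _).

Lemma comp_op_linear (C : bop H) (L : linop V H) (a : R[i]) (u v : V) :
  let f := on (ldom L) (fun u => C (L u)) in
  ldom L u -> ldom L v -> f (a *: u + v) = a *: f u + f v.
Proof.
move=> f Du Dv; have [_ DZ] := ldom_subspace L.
by rewrite /f !onT ?lval_linear ?linearP//; exact: DZ.
Qed.

Definition comp_op (C : bop H) (L : linop V H) : linop V H :=
  LinOp (ldom_subspace L) (@comp_op_linear C L) (@onN _ _ _ _).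

Lemma inner_linearl (x y z : H) (a : R[i]) :
  '<| a *: x + y, z |> = a^* * '<| x, z |> + '<| y, z |>.
Proof.
by rewrite inner_conj inner_linearr rmorphD rmorphM/= -!inner_conj.
Qed.

Lemma inner_form_diag (K L : linop V H) :
  let D := ldom K `&` ldom L in
  exists2 q, sesquilinear_on D q &
    forall u, D u -> on D (fun u => '<| K u, L u |>) u = q u u.
Proof.
move=> D; apply: (@qform_on_diag R V D (fun u v => '<| K u, L v |>)).
split=> a u v w [uK uL] [vK vL] [wK wL].
  by rewrite lval_linear// inner_linearr.
by rewrite lval_linear// inner_linearl.
Qed.

Definition inner_form (K L : linop V H) : qform V :=
  QForm (subspaceI (ldom_subspace K) (ldom_subspace L))
    (inner_form_diag K L) (@onN _ _ _ _).

End Operators.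

Section BoundedOperators.
Context {R : realType} {H : hilbertType R}.

Lemma id_bop_bounded :
  exists M : R[i], forall x : H, `|(idfun : {linear H -> H}) x| <= M * `|x|.
Proof. by exists 1 => x; rewrite mul1r. Qed.

Definition id_bop : bop H := BOp id_bop_bounded.

Lemma comp_bop_bounded (A B : bop H) :
  exists M : R[i], forall x : H, `|(A \o B : {linear H -> H}) x| <= M * `|x|.
Proof.
have [M AM] := bfun_bounded A; have [N BN] := bfun_bounded B.
have [[x x0]|no] := pselect (exists x : H, x != 0); last first.
  exists 0 => x; have [->|x0] := eqVneq x 0; last by case: no; exists x.
  by rewrite linear0 !normr0 mul0r.
have M0 : 0 <= M.
  by rewrite -(pmulr_lge0 M (_ : 0 < `|x|)) ?normr_gt0// (le_trans _ (AM x)).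
exists (M * N) => y; rewrite -mulrA (le_trans (AM _))//.
exact: ler_wpM2l.
Qed.

Definition comp_bop (A B : bop H) : bop H := BOp (comp_bop_bounded A B).

(* The Hilbert space adjoint, selected by its characteristic property; the
   default value is irrelevant because the adjoint always exists (Riesz). *)
Definition adj_bop (C : bop H) : bop H :=
  @xget {classic bop H} C
    [set A : bop H | forall x y, '<| A x, y |> = '<| x, C y |>].

End BoundedOperators.

Record components (R : realType) (h H : hilbertType R) := Components {
  cform : qform h ;
  cL : linop h H ;
  cLt : linop h H ;
  cC : bop H ;
  cL_dom : ldom cL = qdom cform ;
  cLt_dom : ldom cLt = qdom cform
}.

Section Composition.
Context {R : realType} {h H : hilbertType R}.

Definition form_val (c : components h H) (xi : h * H) : R[i] :=
  let: (u, z) := xi in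
  cform c u -
    ('<| z, cL c u |> + '<| cLt c u, z |> + '<| z, cC c z - z |>).

Definition form_dom (c : components h H) : set (h * H)%type :=
  [set xi | qdom (cform c) xi.1].

Lemma form_dom_subspace (c : components h H) : subspace (form_dom c).
Proof.
by have [D0 DZ] := qdom_subspace (cform c); split=> // a u v; exact: DZ.
Qed.

Lemma form_diag (c : components h H) :
  exists2 q, sesquilinear_on (form_dom c) q &
    forall xi, form_dom c xi -> on (form_dom c) (form_val c) xi = q xi xi.
Proof.
have [q [qr ql] gE] := qval_diag (cform c).
have Ll := @lval_linear _ _ _ (cL c); rewrite cL_dom in Ll.
have Ltl := @lval_linear _ _ _ (cLt c); rewrite cLt_dom in Ltl.
exists (fun x y : h * H => q x.1 y.1 -
  ('<| x.2, cL c y.1 |> + '<| cLt c x.1, y.2 |> + '<| x.2, cC c y.2 - y.2 |>));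
  last by move=> [u z] /= Du; rewrite onT//= gE.
have CE a z y : cC c (a *: z + y) - (a *: z + y) =
    a *: (cC c z - z) + (cC c y - y).
  by rewrite linearP opprD addrACA scalerBr.
split=> a [u z] [v y] [w x]; rewrite /form_dom/= => Du Dv Dw.
  by rewrite qr// Ll// CE !inner_linearr; ring.
by rewrite ql// Ltl// !inner_linearl; ring.
Qed.

(* Gamma ~ (gamma, L, Ltilde, C) reads Gamma = form_of c.  The orthogonal sum
   of h and H is the product h * H: only its linear structure is used. *)
Definition form_of (c : components h H) : qform (h * H)%type :=
  QForm (form_dom_subspace c) (form_diag c) (@onN _ _ _ _).

Definition Qclass : set (qform (h * H)%type) := range form_of.

Definition id_components : components h H :=
  @Components R h H zero_form zero_op zero_op id_bop erefl erefl.

Definition Gamma0 : qform (h * H)%type := form_of id_components.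

Definition lhd_form (c1 c2 : components h H) : qform h :=
  add_form (add_form (cform c1) (cform c2))
    (opp_form (inner_form (cLt c1) (cL c2))).

Definition lhd_L (c1 c2 : components h H) : linop h H :=
  add_op (cL c1) (comp_op (cC c1) (cL c2)).

Definition lhd_Lt (c1 c2 : components h H) : linop h H :=
  add_op (comp_op (adj_bop (cC c2)) (cLt c1)) (cLt c2).

Lemma lhd_form_dom (c1 c2 : components h H) :
  qdom (lhd_form c1 c2) = qdom (cform c1) `&` qdom (cform c2).
Proof. by rewrite /= cL_dom cLt_dom setIid. Qed.

Lemma lhd_L_dom (c1 c2 : components h H) :
  ldom (lhd_L c1 c2) = qdom (lhd_form c1 c2).
Proof. by rewrite lhd_form_dom /= !cL_dom. Qed.

Lemma lhd_Lt_dom (c1 c2 : components h H) :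
  ldom (lhd_Lt c1 c2) = qdom (lhd_form c1 c2).
Proof. by rewrite lhd_form_dom /= !cLt_dom. Qed.

Definition lhd_components (c1 c2 : components h H) : components h H :=
  @Components R h H (lhd_form c1 c2) (lhd_L c1 c2) (lhd_Lt c1 c2)
    (comp_bop (cC c1) (cC c2)) (lhd_L_dom c1 c2) (lhd_Lt_dom c1 c2).

(* A choice of components of a form in Qclass (a junk value elsewhere). *)
Definition components_of (G : qform (h * H)%type) : components h H :=
  @xget {classic components h H} id_components
    [set c : components h H | G = form_of c].

Definition lhd (G1 G2 : qform (h * H)%type) : qform (h * H)%type :=
  form_of (lhd_components (components_of G1) (components_of G2)).

End Composition.

Arguments Qclass {R} h H.
Arguments Gamma0 {R} h H.

Record star_monoid_on (T : Type) (A : set T) (op : T -> T -> T) (e : T)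
    (star : T -> T) : Prop := StarMonoidOn {
  star_monoid_op : forall x y, A x -> A y -> A (op x y) ;
  star_monoid_one : A e ;
  star_monoid_star : forall x, A x -> A (star x) ;
  star_monoidA : forall x y z, A x -> A y -> A z ->
    op x (op y z) = op (op x y) z ;
  star_monoid1m : forall x, A x -> op e x = x ;
  star_monoidm1 : forall x, A x -> op x e = x ;
  star_monoidK : forall x, A x -> star (star x) = x ;
  star_monoidM : forall x y, A x -> A y ->
    star (op x y) = op (star y) (star x)
}.

(* Main.v *)
From HB Require Import structures.
Require Import Defs.
From mathcomp Require Import all_boot all_order all_algebra.
From mathcomp Require Import boolp classical_sets reals topology normedtype.
From mathcomp Require Import complex.
From mathcomp Require Import ring lra.

(** A form in the class determines its components, so the composition, which
is defined through a choice of components, can be computed on any components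
at hand ([form_ofP], [lhdE]).  Indeed, once the scalar part of
Gamma[u, zeta] is subtracted, what remains is a linear term, a
conjugate-linear term and a quadratic term in zeta; substituting - zeta and
then i zeta separates the three, and polarization recovers C from its
quadratic form ([quadratic_affine_eq0]).

After this the monoid laws are identities between components.  In
associativity both groupings give the cross terms
<Lt1 u, L2 u> + <Lt2 u, L3 u> + <Lt1 u, C2 (L3 u)>: on the left C2 sits in the
L component of the pair (2, 3), on the right its adjoint sits in the Lt
component of the pair (1, 2).  Passing to adjoint forms exchanges L and Lt and
replaces C by its adjoint, which reverses the composition.

The analytic input is that every bounded operator has an adjoint, that is, the
Riesz representation theorem.  It is obtained by minimizing the real functional
|y|^2 - 2 Re f(y): the parallelogram law makes the filter of almost minimizers
Cauchy, and almost minimizers y almost represent f ([energy_gap]), so that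
their limit represents f. *)

Import Order.TTheory GRing.Theory Num.Theory.
Import numFieldNormedType.Exports.

Local Open Scope classical_set_scope.
Local Open Scope ring_scope.

(** * Inner products *)

Section InnerProduct.
Context {R : realType} {H : hilbertType R}.
Implicit Types x y z : H.

Lemma innerDr x y z : '<| x, y + z |> = '<| x, y |> + '<| x, z |>.
Proof. by rewrite -[y]scale1r inner_linearr mul1r scale1r. Qed.

Lemma innerDl x y z : '<| x + y, z |> = '<| x, z |> + '<| y, z |>.
Proof. by rewrite -[x]scale1r inner_linearl rmorph1 mul1r scale1r. Qed.

Lemma inner0r x : '<| x, 0 |> = 0.
Proof. by apply: (addIr '<| x, 0 |>); rewrite -innerDr !add0r. Qed.

Lemma inner0l x : '<| 0, x |> = 0.
Proof. by rewrite inner_conj inner0r rmorph0. Qed.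

Lemma innerZr (a : R[i]) x y : '<| x, a *: y |> = a * '<| x, y |>.
Proof. by rewrite -[a *: y]addr0 inner_linearr inner0r addr0. Qed.

Lemma innerZl (a : R[i]) x y : '<| a *: x, y |> = a^* * '<| x, y |>.
Proof. by rewrite -[a *: x]addr0 inner_linearl inner0l addr0. Qed.

Lemma innerBr x y z : '<| x, y - z |> = '<| x, y |> - '<| x, z |>.
Proof. by rewrite -scaleN1r innerDr innerZr mulN1r. Qed.

Lemma innerBl x y z : '<| x - y, z |> = '<| x, z |> - '<| y, z |>.
Proof. by rewrite !(inner_conj z) innerBr rmorphB. Qed.

Lemma inner_self_eq0 x : ('<| x, x |> == 0) = (x == 0).
Proof. by rewrite inner_norm sqrf_eq0 normr_eq0. Qed.

Lemma inner_self_ge0 x : 0 <= '<| x, x |>.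
Proof. by rewrite inner_norm exprn_ge0. Qed.

Lemma inner_self_real x : ('<| x, x |>)^* = '<| x, x |>.
Proof. by rewrite -inner_conj. Qed.

Lemma inner_injr x y : (forall z, '<| z, x |> = '<| z, y |>) -> x = y.
Proof.
move=> xy; apply/eqP; rewrite -subr_eq0 -inner_self_eq0 innerBr.
by rewrite xy subrr.
Qed.

Lemma inner_injl x y : (forall z, '<| x, z |> = '<| y, z |>) -> x = y.
Proof.
by move=> xy; apply: inner_injr => z; rewrite inner_conj xy -inner_conj.
Qed.

(** The vector w below is |y|^2 times the component of x orthogonal to y, and
|w|^2 >= 0 is the square of the claim multiplied by |y|^2. *)
Lemma CauchySchwarz x y : `|'<| x, y |>| <= `|x| * `|y|.
Proof.
have [->|y0] := eqVneq y 0; first by rewrite inner0r !normr0 mulr0.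
have yy0 : '<| y, y |> != 0 by rewrite inner_self_eq0.
rewrite -(ler_pXn2r (ltn0Sn 1)) ?nnegrE ?mulr_ge0//.
rewrite exprMn -!inner_norm normCK -(inner_conj x y) -subr_ge0.
have yyp : 0 < '<| y, y |> by rewrite lt_def yy0 inner_self_ge0.
rewrite -(pmulr_rge0 _ yyp).
set w := '<| y, y |> *: x - '<| y, x |> *: y.
suff -> : '<| y, y |> * ('<| x, x |> * '<| y, y |> - '<| x, y |> * '<| y, x |>)
          = '<| w, w |> by exact: inner_self_ge0.
rewrite /w !(innerBl, innerBr, innerZl, innerZr) inner_self_real.
by rewrite -(inner_conj y x); ring.
Qed.

End InnerProduct.

(** * The Riesz representation theorem *)

Section Riesz.
Context {R : realType} {H : hilbertType R} (f : H -> R[i]) (M : R[i])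
  (flin : forall (a : R[i]) (x y : H), f (a *: x + y) = a * f x + f y)
  (M0 : 0 <= M) (fM : forall x, `|f x| <= M * `|x|).

Let energy (y : H) : R := complex.Re ('<| y, y |> - (f y + (f y)^*)).

Let energyE y : (energy y)%:C%C = '<| y, y |> - (f y + (f y)^*).
Proof.
apply: RRe_real; apply/CrealP.
by rewrite rmorphB rmorphD /= conjCK inner_self_real [X in _ - X]addrC.
Qed.

Let fD x y : f (x + y) = f x + f y.
Proof. by rewrite -[x]scale1r flin mul1r scale1r. Qed.

Let f0 : f 0 = 0.
Proof. by apply: (addIr (f 0)); rewrite -fD !add0r. Qed.

Let fZ (a : R[i]) x : f (a *: x) = a * f x.
Proof. by rewrite -[a *: x]addr0 flin f0 addr0. Qed.

Let energy_bounded : has_lbound (range energy).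
Proof.
exists (complex.Re (- M ^+ 2)) => _ [y _ <-].
suff : - M ^+ 2 <= (energy y)%:C%C by rewrite lecE => /andP[].
have f2 : f y + (f y)^* <= M * `|y| *+ 2.
  have -> : f y + (f y)^* = 'Re (f y) *+ 2 by rewrite ReE; field.
  by rewrite ler_pMn2r// (le_trans (leif_Re_Creal _)).
rewrite energyE inner_norm -subr_ge0.
have : 0 <= (`|y| - M) ^+ 2 + (M * `|y| *+ 2 - (f y + (f y)^*)).
  rewrite addr_ge0 ?subr_ge0// real_exprn_even_ge0//.
  by rewrite rpredB// ger0_real.
by congr (0 <= _); ring.
Qed.

Let energy_inf_le y : (inf (range energy))%:C%C <= (energy y)%:C%C.
Proof. by rewrite lecR; apply: ge_inf => //; exists y. Qed.

(** How far y is from representing f in the direction w is bounded by its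
excess energy.  On the line y + t w the energy is a quadratic polynomial in the
complex number t; at its minimizer, the t below, it is smaller than the energy
of y by exactly |<y, w> - f w|^2 / |w|^2, and it cannot drop below the
infimum. *)
Let energy_gap y w :
  `|'<| y, w |> - f w| ^+ 2 <=
    ((energy y)%:C%C - (inf (range energy))%:C%C) * '<| w, w |>.
Proof.
have [->|w0] := eqVneq w 0.
  by rewrite !inner0r f0 subrr normr0 mulr0 expr0n.
have ww0 : '<| w, w |> != 0 by rewrite inner_self_eq0.
have wwp : 0 < '<| w, w |> by rewrite lt_def ww0 inner_self_ge0.
rewrite -ler_pdivrMr// lerBrDr -lerBrDl.
set t := - ('<| y, w |> - f w)^* / '<| w, w |>.
apply: le_trans (energy_inf_le (y + t *: w)) _.
rewrite !energyE normCK /t !(innerDl, innerDr, innerZl, innerZr) fD fZ.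
rewrite !(rmorphM, rmorphD, rmorphB, rmorphN, fmorphV)/= !conjCK.
rewrite inner_self_real -(inner_conj y w).
by rewrite le_eqVlt; apply/orP; left; apply/eqP; field.
Qed.

(** The energy of the midpoint of y and w is at least the infimum; by the
parallelogram law this bounds the distance between y and w. *)
Let energy_parallelogram y w :
  `|y - w| ^+ 2 <= ((energy y)%:C%C + (energy w)%:C%C
    - (inf (range energy))%:C%C *+ 2) *+ 2.
Proof.
have := energy_inf_le (2^-1 *: (y + w)); rewrite -subr_ge0.
move=> /(mulrn_wge0 4); rewrite -[X in _ -> is_true X]subr_ge0.
rewrite !energyE -inner_norm.
rewrite !(innerBl, innerBr, innerZl, innerZr, innerDl, innerDr).
rewrite fZ fD fmorphV rmorph_nat rmorphM rmorphD /= fmorphV rmorph_nat.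
by congr (0 <= _); field.
Qed.

(** A filter takes the place of a minimizing sequence. *)
Let near_min : set_system H := filter_from [set e : R | 0 < e]
  (fun e => [set y | energy y < inf (range energy) + e]).

Let near_min_filter : ProperFilter near_min.
Proof.
apply: filter_from_proper; last first.
  move=> e e0; have [] := @inf_adherent _ (range energy) e e0.
    by split; [exists (energy 0), 0|exact: energy_bounded].
  by move=> _ [y _ <-] ye; exists y.
apply: filter_from_filter; first by exists 1; rewrite /= ltr01.
move=> d e d0 e0; exists (Num.min d e); first by rewrite /= lt_min d0.
by move=> y /=; rewrite -ltrBlDl lt_min !ltrBlDl => /andP.
Qed.

Let near_min_cauchy : cauchy near_min.
Proof.
have nF := near_min_filter; apply/cauchy_ballP => e e0.
have eE : (complex.Re e)%:C%C = e by rewrite RRe_real// gtr0_real.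
have r0 : 0 < complex.Re e by rewrite -ltcR eE.
(* The bound of [energy_parallelogram] is four times the common excess. *)
exists ([set y | energy y < inf (range energy) + complex.Re e ^+ 2 / 4],
        [set y | energy y < inf (range energy) + complex.Re e ^+ 2 / 4]) => /=.
  by split; exists (complex.Re e ^+ 2 / 4) => //=; rewrite divr_gt0// exprn_gt0.
move=> [y w] [/= yE wE]; rewrite -ball_normE /ball_ /=.
rewrite -(ltr_pXn2r (ltn0Sn 1)) ?nnegrE ?(ltW e0)//.
apply: le_lt_trans (energy_parallelogram _ _) _.
rewrite -[X in _ < X ^+ _]eE -!(rmorphD, rmorphMn, rmorphXn, rmorphB)/= ltcR.
lra.
Qed.

(** The limit z of the almost minimizers y represents f, because <y, w> tends
to <z, w> and, by [energy_gap], to f w. *)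
Lemma riesz_representation : exists z, forall w, '<| z, w |> = f w.
Proof.
have nF := near_min_filter.
have /cvg_ex [z zlim] : cvg near_min by exact: cauchy_cvg.
exists z => w; apply/eqP; rewrite -subr_eq0 -normr_eq0; apply: contraT => q0.
set q := `|_| in q0.
have qp : 0 < q by rewrite lt_def q0 normr_ge0.
have w0 : w != 0.
  by apply: contra_neq q0 => w0; rewrite /q w0 inner0r f0 subrr normr0.
have wp : 0 < `|w| by rewrite normr_gt0.
(* With this e, an almost minimizer y at distance less than e of z makes both
   <z - y, w> and <y, w> - f w small enough for their sum to be below q. *)
pose e := q / (2 * `|w|).
have e0 : 0 < e by rewrite divr_gt0// mulr_gt0.
have eE : (complex.Re e)%:C%C = e by rewrite RRe_real// gtr0_real.
have r0 : 0 < complex.Re e by rewrite -ltcR eE.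
have zF : near_min (ball z e) by apply: zlim; exact: nbhsx_ballx.
have eF : near_min [set y | energy y < inf (range energy) + complex.Re e ^+ 2].
  by exists (complex.Re e ^+ 2) => //=; rewrite exprn_gt0.
have [y [yz ye]] := filter_ex (filterI zF eF).
rewrite -ball_normE /ball_ /= in yz; rewrite /= in ye.
have yf : `|'<| y, w |> - f w| <= e * `|w|.
  rewrite -(ler_pXn2r (ltn0Sn 1)) ?nnegrE ?(mulr_ge0 (ltW e0))//.
  apply: le_trans (energy_gap _ _) _; rewrite exprMn -inner_norm.
  rewrite ler_wpM2r ?inner_self_ge0// lerBlDl -eE -rmorphXn/= -rmorphD/=.
  by rewrite lecR ltW.
have qE : q = e * `|w| + e * `|w| by rewrite /e; field; rewrite normr_eq0.
suff : q < e * `|w| + e * `|w| by rewrite -qE ltxx.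
apply: (@le_lt_trans _ _ (`|'<| z - y, w |>| + `|'<| y, w |> - f w|)).
  by rewrite innerBl (le_trans _ (ler_normD _ _))// addrA subrK.
by rewrite ltr_leD// (le_lt_trans (CauchySchwarz _ _))// ltr_pM2r.
Qed.

End Riesz.

(** * Adjoints of bounded operators *)

Section Adjoint.
Context {R : realType} {H : hilbertType R}.

(** A bound of an operator on the zero space may be any complex number, so it
is replaced by its modulus. *)
Lemma bop_bound_ge0 (C : bop H) :
  exists2 M : R[i], 0 <= M & forall x, `|C x| <= M * `|x|.
Proof.
have [M CM] := bfun_bounded C; exists `|M| => // x.
have Mx0 : 0 <= M * `|x| by apply: le_trans (CM x).
by rewrite -[`|x|]normr_id -normrM ger0_norm.
Qed.

(** The vector A x represents the functional y |-> <x, C y>.  The bound comes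
from |A x|^2 = <x, C (A x)> <= |x| M |A x|. *)
Lemma adjoint_exists (C : bop H) :
  exists A : bop H, forall x y, '<| A x, y |> = '<| x, C y |>.
Proof.
have [M M0 CM] := bop_bound_ge0 C.
have /choice [A AP] : forall x, exists z, forall y, '<| z, y |> = '<| x, C y |>.
  move=> x; apply: (@riesz_representation _ _ _ (M * `|x|)).
  - by move=> a y z; rewrite linearP inner_linearr.
  - by rewrite mulr_ge0.
  - move=> y; apply: le_trans (CauchySchwarz _ _) _.
    by rewrite mulrAC mulrC ler_wpM2r.
have Alin : linear A.
  move=> a x y; apply: inner_injl => z.
  by rewrite inner_linearl !AP inner_linearl.
pose Al : {linear H -> H} := HB.pack A (GRing.isLinear.Build _ _ _ _ A Alin).
suff Abd : exists N : R[i], forall x, `|Al x| <= N * `|x| by exists (BOp Abd).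
exists M => x /=; have [->|Ax0] := eqVneq (A x) 0.
  by rewrite normr0 mulr_ge0.
rewrite -(ler_pM2r (_ : 0 < `|A x|)) ?normr_gt0// -expr2 -inner_norm AP.
apply: le_trans (real_ler_norm _) _.
  by rewrite -AP ger0_real// inner_self_ge0.
apply: le_trans (CauchySchwarz _ _) _.
by rewrite mulrAC mulrC ler_wpM2r.
Qed.

Lemma inner_adjl (C : bop H) x y : '<| adj_bop C x, y |> = '<| x, C y |>.
Proof.
have : [set A : bop H | forall x y, '<| A x, y |> = '<| x, C y |>] (adj_bop C).
  by apply: (@xgetPex {classic bop H}); exact: adjoint_exists.
exact.
Qed.

Lemma inner_adjr (C : bop H) x y : '<| x, adj_bop C y |> = '<| C x, y |>.
Proof. by rewrite inner_conj inner_adjl -inner_conj. Qed.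

Lemma eq_adj_bop (C D : bop H) : C =1 D -> adj_bop C =1 adj_bop D.
Proof.
by move=> CD x; apply: inner_injl => y; rewrite !inner_adjl CD.
Qed.

Lemma adj_bopK (C : bop H) : adj_bop (adj_bop C) =1 C.
Proof. by move=> x; apply: inner_injl => y; rewrite inner_adjl inner_adjr. Qed.

Lemma adj_comp_bop (C D : bop H) :
  adj_bop (comp_bop C D) =1 comp_bop (adj_bop D) (adj_bop C).
Proof.
by move=> x; apply: inner_injl => y; rewrite inner_adjl /= !inner_adjl.
Qed.

Lemma adj_id_bop : adj_bop (@id_bop R H) =1 id.
Proof. by move=> x; apply: inner_injl => y; rewrite inner_adjl. Qed.

End Adjoint.

(** * A form determines its components *)

Section Uniqueness.
Context {R : realType} {h H : hilbertType R}.
Implicit Types c : components h H.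

(** The separation step behind complex polarization: of a and b one is linear
and the other conjugate-linear in a common vector v, so that replacing v by i v
turns a + b into i a - i b, up to sign. *)
Lemma add_sub_Ci_eq0 (a b : R[i]) : a + b = 0 -> 'i * a - 'i * b = 0 -> a = 0.
Proof.
move=> ab0 /eqP; rewrite -mulrBr mulf_eq0 (negPf (neq0Ci _)) subr_eq0/= => /eqP.
move=> ab; apply/eqP; move: ab0; rewrite -ab -mulr2n => /eqP.
by rewrite mulrn_eq0.
Qed.

(** Adding the values at z and - z separates the terms of degree one from the
quadratic one; the substitution of i z then separates linear from
conjugate-linear terms. *)
Lemma quadratic_affine_eq0 (k l : H) (D : {linear H -> H}) :
  (forall z, '<| z, l |> + '<| k, z |> + '<| z, D z |> = 0) ->
  [/\ l = 0, k = 0 & D =1 fun=> 0].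
Proof.
move=> E.
have E1 z : '<| z, l |> + '<| k, z |> = 0.
  suff : ('<| z, l |> + '<| k, z |>) *+ 2 = 0.
    by move=> /eqP; rewrite mulrn_eq0 => /eqP.
  have := subrr (0 : R[i]); rewrite -{1}(E z) -{1}(E (- z)) => <-.
  rewrite -(scaleN1r z) linearZ !innerZl !innerZr rmorphN rmorph1; ring.
have E2 z : '<| z, D z |> = 0 by rewrite -(E z) E1 add0r.
have l0 : l = 0.
  apply: inner_injr => z; rewrite inner0r.
  apply: (@add_sub_Ci_eq0 _ '<| k, z |>); first exact: E1.
  apply: oppr_inj; rewrite oppr0 -(E1 ('i *: z)) innerZl innerZr conjCi.
  by rewrite opprB mulNr addrC.
have k0 : k = 0.
  by apply: inner_injl => z; rewrite inner0l -(E1 z) l0 inner0r add0r.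
split=> // w; apply: inner_injr => z; rewrite inner0r.
have P u v : '<| u, D v |> + '<| v, D u |> = 0.
  by have := E2 (u + v); rewrite linearD innerDl !innerDr !E2 add0r addr0.
apply: (@add_sub_Ci_eq0 _ '<| w, D z |>); first exact: P.
by rewrite -(P z ('i *: w)) [D ('i *: w)]linearZ innerZl innerZr conjCi mulNr.
Qed.

Lemma qform_eq (V : lmodType R[i]) (g g' : qform V) :
  qdom g = qdom g' -> (forall u, qdom g u -> g u = g' u) -> g = g'.
Proof.
move=> E gg'; have {}gg' : qval g = qval g'.
  apply/funext => u; have [Du|nDu] := pselect (qdom g u); first exact: gg'.
  by rewrite !qval_off// -E.
case: g g' E gg' => [D f s d o] [D' f' s' d' o'] /= DE fE.
by subst; congr QForm; exact: Prop_irrelevance.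
Qed.

(** Equality of components up to extensionality of the functions involved,
which leaves aside the proofs bundled with them. *)
Definition same_components c c' : Prop :=
  [/\ qdom (cform c) = qdom (cform c'),
      forall u, qdom (cform c) u ->
        [/\ cform c u = cform c' u, cL c u = cL c' u & cLt c u = cLt c' u] &
      cC c =1 cC c'].

(** Taking zeta = 0 gives the scalar form; the rest is
[quadratic_affine_eq0] applied to the differences of the components.  The
domain always contains u = 0, which suffices to compare the operators C. *)
Lemma form_ofP c c' : form_of c = form_of c' <-> same_components c c'.
Proof.
split=> [E|[E G C]]; last first.
  have DE : form_dom c = form_dom c' by rewrite /form_dom E.
  apply: qform_eq => [//|[u z] Du /=]; rewrite !onT//; last by rewrite -DE.
  by have [|ge Le Lte] := G u; rewrite //= ge Le Lte C.
have DE : qdom (cform c) = qdom (cform c').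
  by apply/funext => u; have := congr1 (fun g => qdom g (u, 0)) E.
have VE u z : qdom (cform c) u -> form_val c (u, z) = form_val c' (u, z).
  move=> Du; have /= := congr1 (fun g : qform _ => g (u, z)) E.
  by rewrite !onT// /form_dom/= -DE.
have GE u : qdom (cform c) u -> cform c u = cform c' u.
  move=> Du; have := VE u 0 Du.
  by rewrite /= !(inner0l, inner0r) !addr0 !subr0.
have S u : qdom (cform c) u -> [/\ cL c u = cL c' u, cLt c u = cLt c' u &
    cC c =1 cC c'].
  move=> Du; have [z|l0 k0 D0] := @quadratic_affine_eq0
    (cLt c u - cLt c' u) (cL c u - cL c' u) (cC c \- cC c').
    have /= := VE u z Du; rewrite (GE u Du) => /addrI/oppr_inj/eqP.
    rewrite -subr_eq0 => /eqP e; rewrite -[RHS]e.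
    by rewrite !(innerBl, innerBr); ring.
  split; [exact: subr0_eq|exact: subr0_eq|].
  by move=> z; apply: subr0_eq; have := D0 z.
split=> // [u Du|]; first by have [-> -> _] := S u Du; rewrite GE.
by have [D0 _] := qdom_subspace (cform c); have [] := S 0 D0.
Qed.

Lemma components_ofK c : form_of (components_of (form_of c)) = form_of c.
Proof.
have : [set c' | form_of c = form_of c'] (components_of (form_of c)).
  by apply: (@xgetPex {classic components h H}); exists c.
by move=> /= <-.
Qed.

End Uniqueness.

(** * The star-monoid of forms *)

Section StarMonoid.
Context {R : realType} {h H : hilbertType R}.
Implicit Types c d : components h H.

Lemma lhd_dom c d : qdom (cform (lhd_components c d)) =
  qdom (cform c) `&` qdom (cform d).
Proof. exact: lhd_form_dom. Qed.

Section Evaluation.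
Context (c d : components h H) (u : h).
Context (cu : qdom (cform c) u) (du : qdom (cform d) u).

Lemma lhd_formE : cform (lhd_components c d) u =
  cform c u + cform d u - '<| cLt c u, cL d u |>.
Proof. by rewrite /= !onT//= ?cL_dom ?cLt_dom//; split. Qed.

Lemma lhd_LE : cL (lhd_components c d) u = cL c u + cC c (cL d u).
Proof. by rewrite /= !onT//= ?cL_dom ?cLt_dom//; split. Qed.

Lemma lhd_LtE :
  cLt (lhd_components c d) u = adj_bop (cC d) (cLt c u) + cLt d u.
Proof. by rewrite /= !onT//= ?cL_dom ?cLt_dom//; split. Qed.

End Evaluation.

Lemma same_lhd c c' d d' : same_components c c' -> same_components d d' ->
  same_components (lhd_components c d) (lhd_components c' d').
Proof.
move=> [cE cG cB] [dE dG dB]; split.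
- by rewrite !lhd_dom cE dE.
- move=> u; rewrite lhd_dom => -[cu du].
  have [g1 L1 Lt1] := cG u cu; have [g2 L2 Lt2] := dG u du.
  have c'u : qdom (cform c') u by rewrite -cE.
  have d'u : qdom (cform d') u by rewrite -dE.
  rewrite !lhd_formE// !lhd_LE// !lhd_LtE//.
  by rewrite g1 g2 L1 L2 Lt1 Lt2 cB (eq_adj_bop _ _ dB).
- by move=> z /=; rewrite cB dB.
Qed.

(** The components chosen inside [lhd] can differ from c and d only by
[same_components], which the composition of components respects. *)
Lemma lhdE c d : lhd (form_of c) (form_of d) = form_of (lhd_components c d).
Proof.
by apply/form_ofP; apply: same_lhd; apply/form_ofP; exact: components_ofK.
Qed.

Definition adj_components c : components h H :=
  @Components R h H (adj_form (cform c)) (cLt c) (cL c) (adj_bop (cC c))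
    (cLt_dom c) (cL_dom c).

Lemma adj_dom c : qdom (cform (adj_components c)) = qdom (cform c).
Proof. by []. Qed.

Lemma adj_formE c u : qdom (cform c) u ->
  cform (adj_components c) u = (cform c u)^*.
Proof. exact: onT. Qed.

Lemma adj_LE c : cL (adj_components c) = cLt c.
Proof. by []. Qed.

Lemma adj_LtE c : cLt (adj_components c) = cL c.
Proof. by []. Qed.

Lemma adj_CE c : cC (adj_components c) = adj_bop (cC c).
Proof. by []. Qed.

Lemma adj_form_of c : adj_form (form_of c) = form_of (adj_components c).
Proof.
apply: qform_eq => // -[u z] Du; rewrite /= !onT//=.
rewrite !(innerBr, rmorphB, rmorphD) /= -!inner_conj inner_adjr.
by rewrite onT// [X in _ - (X + _)]addrC.
Qed.

Local Notation one := (@id_components R h H).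

Lemma same_lhd1m c : same_components (lhd_components one c) c.
Proof.
have DE : qdom (cform (lhd_components one c)) = qdom (cform c).
  by rewrite lhd_dom setTI.
split=> // u; rewrite DE => Du.
rewrite lhd_formE// lhd_LE// lhd_LtE//=.
rewrite inner0l subr0 !add0r; split=> //.
by rewrite linear0 add0r.
Qed.

Lemma same_lhdm1 c : same_components (lhd_components c one) c.
Proof.
have DE : qdom (cform (lhd_components c one)) = qdom (cform c).
  by rewrite lhd_dom setIT.
split=> // u; rewrite DE => Du.
rewrite lhd_formE// lhd_LE// lhd_LtE//=.
by rewrite inner0r subr0 linear0 !addr0 adj_id_bop.
Qed.

Lemma same_lhdA c d e : same_components
  (lhd_components c (lhd_components d e))
  (lhd_components (lhd_components c d) e).
Proof.
split=> // [|u]; first by rewrite !lhd_dom setIA.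
rewrite !lhd_dom => -[cu [du eu]].
have cdu : qdom (cform (lhd_components c d)) u by rewrite lhd_dom.
have deu : qdom (cform (lhd_components d e)) u by rewrite lhd_dom.
rewrite !lhd_formE// !lhd_LE// !lhd_LtE//.
split.
- by rewrite innerDr innerDl inner_adjl; ring.
- by rewrite linearD addrA.
- by rewrite linearD addrA adj_comp_bop.
Qed.

Lemma same_adj_lhd c d : same_components (adj_components (lhd_components c d))
  (lhd_components (adj_components d) (adj_components c)).
Proof.
split=> [|u|z]; last exact: adj_comp_bop.
  by rewrite adj_dom !lhd_dom !adj_dom setIC.
rewrite adj_dom lhd_dom => -[cu du].
rewrite lhd_formE// lhd_LE// lhd_LtE// !adj_formE// ?lhd_dom//.
rewrite !adj_LE !adj_LtE !adj_CE lhd_formE// lhd_LE// lhd_LtE//; split.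
- by rewrite !(rmorphB, rmorphD) /= -inner_conj [X in X - _]addrC.
- by rewrite addrC.
- by rewrite adj_bopK addrC.
Qed.

Lemma adj_componentsK c : same_components (adj_components (adj_components c)) c.
Proof.
split=> // [u Du|z]; last exact: adj_bopK.
by rewrite !adj_formE// conjCK.
Qed.

Lemma adj_form_lhd (G1 G2 : qform (h * H)%type) :
  Qclass h H G1 -> Qclass h H G2 ->
  adj_form (lhd G1 G2) = lhd (adj_form G2) (adj_form G1).
Proof.
move=> [c _ <-] [d _ <-]; rewrite lhdE !adj_form_of lhdE.
by apply/form_ofP; exact: same_adj_lhd.
Qed.

Lemma Qclass_star_monoid :
  star_monoid_on (Qclass h H) lhd (Gamma0 h H) adj_form.
Proof.
split.
- by move=> _ _ [c _ <-] [d _ <-]; rewrite lhdE; exists (lhd_components c d).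
- by exists one.
- by move=> _ [c _ <-]; rewrite adj_form_of; exists (adj_components c).
- move=> _ _ _ [c _ <-] [d _ <-] [e _ <-].
  by rewrite !lhdE; apply/form_ofP; exact: same_lhdA.
- by move=> _ [c _ <-]; rewrite lhdE; apply/form_ofP; exact: same_lhd1m.
- by move=> _ [c _ <-]; rewrite lhdE; apply/form_ofP; exact: same_lhdm1.
- move=> _ [c _ <-]; rewrite !adj_form_of.
  by apply/form_ofP; exact: adj_componentsK.
- exact: adj_form_lhd.
Qed.

End StarMonoid.

Theorem proposition6p3 (R : realType) (h H : hilbertType R) :
  (forall c1 c2 : components h H,
     lhd (form_of c1) (form_of c2) = form_of (lhd_components c1 c2)) /\
  star_monoid_on (Qclass h H) lhd (Gamma0 h H) adj_form /\
  (forall G1 G2, Qclass h H G1 -> Qclass h H G2 ->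
     adj_form (lhd G1 G2) = lhd (adj_form G2) (adj_form G1)).
Proof.
split; [exact: lhdE|split; [exact: Qclass_star_monoid|exact: adj_form_lhd]].
Qed.
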